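(* For almost all graphs $G$ with $n$ vertices, we have $$\ell(G) \geq n - (2 \log_2 n + 2 \log_2 \log_2 n).$$ That is, the probability that the random graph $G=G(n,1/2)$ satisfies this inequality tends to $1$ as $n\to\infty$.
   Context: All graphs are finite and simple. Given a finite alphabet $\Sigma$, a decoder is a set of ordered pairs $D\subseteq\Sigma^2$. For a word $w$ with letters $w(1),\dots,w(n)\in\Sigma$, the letter graph $\Gamma_D(w)$ is the graph with vertex set $\{1,\dots,n\}$ and with an edge $ij$ for each $i<j$ such that $(w(i),w(j))\in D$. If $|\Sigma|=k$, then $\Gamma_D(w)$ is called a $k$-letter graph. The lettericity $\ell(G)$ of a graph $G$ is the least integer $k$ such that $G$ is isomorphic to a $k$-letter graph. The random graph $G(n,1/2)$ is the graph on $n$ labeled vertices in which each edge appears independently with probability $1/2$ (so every labeled $n$-vertex graph occurs with equal probability). *)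

(* Defs.v *)
(* MathComp + MathComp-Analysis *)
From HB Require Import structures.
From mathcomp Require Import all_boot all_order all_algebra.
From mathcomp Require Import all_classical all_reals all_analysis.
Import Order.TTheory GRing.Theory Num.Theory.
Import numFieldNormedType.Exports.

Set Implicit Arguments.
Unset Strict Implicit.
Unset Printing Implicit Defensive.

Local Open Scope ring_scope.

(* A finite simple graph on V, as a set of two-element subsets of V. *)
Record sgraph (V : finType) := SGraph {
  edges : {set {set V}};
  edges_card2 : [forall e in edges, #|e| == 2%N] }.

HB.instance Definition _ (V : finType) := [isSub for @edges V].
HB.instance Definition _ (V : finType) := [Finite of sgraph V by <:].

(* False when x = y, since [set x; x] is a singleton. *)
Definition adj (V : finType) (G : sgraph V) (x y : V) : bool :=
  [set x; y] \in edges G.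

Definition isomorphic (V W : finType) (G : sgraph V) (H : sgraph W) : Prop :=
  exists2 f : V -> W, bijective f & forall x y, adj G x y = adj H (f x) (f y).

Section LetterGraph.
Variables (Sigma : finType) (D : {set Sigma * Sigma}) (n : nat).
Variable w : n.-tuple Sigma.

Definition letter_edges : {set {set 'I_n}} :=
  [set [set ij.1; ij.2] |
    ij : 'I_n * 'I_n & (ij.1 < ij.2)%N && ((tnth w ij.1, tnth w ij.2) \in D)].

Lemma letter_edges_card2 : [forall e in letter_edges, #|e| == 2%N].
Proof.
apply/forall_inP => e /imsetP[[i j]].
rewrite inE => /andP[/= lt_ij ijD] ->.
by rewrite cards2 -val_eqE (ltn_eqF lt_ij).
Qed.

(* Positions are numbered from 0. *)
Definition letter_graph : sgraph 'I_n := SGraph letter_edges_card2.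

Lemma adj_letter_graph (i j : 'I_n) : (i < j)%N ->
  adj letter_graph i j = ((tnth w i, tnth w j) \in D).
Proof.
move=> lt_ij; rewrite /adj /=; apply/imsetP/idP => [[[a b]]|wD]; last first.
  by exists (i, j); rewrite // inE /= lt_ij.
rewrite inE /= => /andP[lt_ab abD] E.
have: i \in [set a; b] by rewrite -E set21.
have: j \in [set a; b] by rewrite -E set22.
rewrite !inE => /orP[]/eqP ej /orP[]/eqP ei; subst => //.
- by rewrite ltnn in lt_ij.
- by rewrite ltnNge (ltnW lt_ab) in lt_ij.
- by rewrite ltnn in lt_ij.
Qed.

End LetterGraph.

Lemma adjC (V : finType) (G : sgraph V) x y : adj G x y = adj G y x.
Proof. by rewrite /adj finset.setUC. Qed.

Lemma adjxx (V : finType) (G : sgraph V) x : adj G x x = false.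
Proof.
apply/negP => xx; have /forall_inP/(_ _ xx) := edges_card2 G.
by rewrite finset.setUid cards1.
Qed.

(* The letters of Sigma need not all occur in the word. *)
Definition is_letter_graph (V : finType) (G : sgraph V) (k : nat) : Prop :=
  exists (Sigma : finType) (D : {set Sigma * Sigma}) (n : nat)
    (w : n.-tuple Sigma), #|Sigma| = k /\ isomorphic G (letter_graph D w).

Lemma ex_is_letter_graph (V : finType) (G : sgraph V) :
  exists k, `[< is_letter_graph G k >].
Proof.
exists #|V|; apply/asboolP.
exists V, [set xy | adj G xy.1 xy.2], #|V|, [tuple enum_val i | i < #|V|].
split=> //; exists enum_rank; first exact: enum_rank_bij.
move=> x y; case: (ltngtP (enum_rank x) (enum_rank y)) => [lt|lt|/val_inj eq].
- by rewrite adj_letter_graph // !tnth_mktuple inE /= !enum_rankK.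
- by rewrite adjC [RHS]adjC adj_letter_graph // !tnth_mktuple inE /= !enum_rankK.
- by rewrite -(enum_rank_inj eq) !adjxx.
Qed.

Definition lettericity (V : finType) (G : sgraph V) : nat :=
  ex_minn (ex_is_letter_graph G).

Section RandomGraph.
Variables (R : realType) (n : nat) (p : R).

(* Probability that G(n, p) is the labelled graph G: each of the possible
   edges is present independently with probability p. *)
Definition Gnp_pmf (G : sgraph 'I_n) : R :=
  \prod_(e : {set 'I_n} | #|e| == 2%N) (if e \in edges G then p else 1 - p).

Definition Gnp_prob (A : {set sgraph 'I_n}) : R := \sum_(G in A) Gnp_pmf G.

End RandomGraph.

Definition log2 (R : realType) (x : R) : R := ln x / ln 2.

(* Main.v *)
(* Suppose G is a letter graph on a word w with at least s repeated letters.
   Choose s positions T whose letters already occurred before, and let F be the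
   set of first occurrences of those letters, r = |F| <= s.  The graph induced on
   the s + r chosen vertices is determined by their order, the position of F
   among them, a map T -> F, and a decoder on F.  Hence at most
     2^(s+r) r^s 2^(r^2) n^(s+r) 2^('C(n,2) - 'C(s+r,2))
   graphs are of this kind.  Using letters named by their first occurrence, rather
   than all words over r letters, saves a factor of about r!, and this makes the
   bound o(2^'C(n,2)), even after summation over r, as soon as
   2^s >= (n log2 n)^2. *)
Require Import Defs.
From HB Require Import structures.
From mathcomp Require Import all_boot all_order all_algebra.
From mathcomp Require Import zify ring lra.

Set Implicit Arguments.
Unset Strict Implicit.
Unset Printing Implicit Defensive.

(** * Counting graphs with prescribed adjacencies *)

Lemma leq_card_bigcup (T I : finType) (P : pred I) (A : I -> {set T}) :
  #|\bigcup_(i | P i) A i| <= \sum_(i | P i) #|A i|.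
Proof.
elim/big_rec2: _ => [|i n B _ IH]; first by rewrite cards0.
by rewrite (leq_trans (leq_card_setU _ _)) // leq_add2l.
Qed.

Lemma card_sgraph (V : finType) : #|{: sgraph V}| = 2 ^ 'C(#|V|, 2).
Proof.
rewrite -card_draws -card_powerset -(card_imset _ val_inj); apply: eq_card => E.
rewrite powersetE; apply/imsetP/subsetP => [[G _ -> e]|sE].
  by rewrite inE; apply: (forall_inP (edges_card2 G)).
have cE : [forall e in E, #|e| == 2%N].
  by apply/forall_inP => e /sE; rewrite inE.
by exists (SGraph cE).
Qed.

(** Members of [P] agree on all pairs inside [S], so each is determined by its edges outside [K], a
    set of the remaining ['C(#|V|, 2) - 'C(#|S|, 2)] pairs. *)
Lemma card_sgraph_prescribed (V : finType) (S : {set V}) (P : {set sgraph V}) :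
    {in P &, forall G H, {in S &, forall x y, adj G x y = adj H x y}} ->
  #|P| * 2 ^ 'C(#|S|, 2) <= 2 ^ 'C(#|V|, 2).
Proof.
move=> adjP.
pose K := [set e : {set V} | e \subset S & #|e| == 2].
pose E2 := [set e : {set V} | #|e| == 2].
have sKE : K \subset E2 by apply/subsetP => e; rewrite !inE => /andP[].
rewrite -cards_draws -card_draws -/K -/E2 -(cardsID K E2) (finset.setIidPr sKE).
rewrite addnC expnD leq_mul2r expn_eq0 /= -card_powerset.
have rest_inj : {in P &, injective (fun G : sgraph V => edges G :\: K)}.
  move=> G H GP HP /setP eqGH; apply/val_inj/setP => e /=.
  have [eK|eNK] := boolP (e \in K); last first.
    by have := eqGH e; rewrite !in_setD (negPf eNK).
  move: eK; rewrite inE => /andP[/subsetP eS /cards2P[x [y [_ eE]]]].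
  by rewrite eE; apply: adjP; rewrite // eS // eE !inE eqxx ?orbT.
rewrite -(card_in_imset rest_inj) subset_leq_card //; apply/subsetP => _ /imsetP[G _ ->].
rewrite powersetE; apply: finset.setSD; apply/subsetP => e.
by rewrite inE; apply: (forall_inP (edges_card2 G)).
Qed.

(** * Numerical estimates *)

Lemma leq_expn2r (e m n : nat) : m <= n -> m ^ e <= n ^ e.
Proof. by case: e => // e; rewrite leq_exp2r. Qed.

(** Absorbs constant factors into [s ^ r]. If [K * r <= s], the factor [s ^ s] suffices; otherwise
    [s < K * r] gives [K ^ s <= (K ^ K) ^ r <= s ^ r]. *)
Lemma repeated_letters_bound (K s r : nat) :
  0 < K -> K ^ K <= s -> r <= s -> (K * r) ^ s <= s ^ (s + r).
Proof.
move=> K0 Ks rs; have s0 : 0 < s by apply: leq_trans Ks; rewrite expn_gt0 K0.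
rewrite expnD; have [le|lt] := leqP (K * r) s.
  by rewrite (leq_trans (leq_expn2r s le)) // leq_pmulr // expn_gt0 s0.
rewrite expnMn mulnC leq_mul ?leq_expn2r //.
by rewrite (leq_trans _ (leq_expn2r r Ks)) // -expnM leq_pexp2l // ltnW.
Qed.

(* With m = s + r, squaring and multiplying by 2^m s^(2m) turns n into n^2 s^2
   and 'C(m, 2) into m^2, and it remains to use s m + 2 r^2 <= m^2. *)
Lemma encodings_bound (C n s r : nat) : 0 < C ->
    (16 * C) ^ (16 * C) <= s -> n ^ 2 * s ^ 2 <= C * 2 ^ s -> r <= s ->
  2 ^ (s + r) * r ^ s * 2 ^ (r ^ 2) * n ^ (s + r) * 2 ^ s <= 2 ^ 'C(s + r, 2).
Proof.
move=> C0 Ks ns rs; set m := s + r.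
have K0 : 0 < 16 * C by rewrite muln_gt0.
have s0 : 0 < s by apply: leq_trans Ks; rewrite expn_gt0 K0.
have binm : 'C(m, 2) * 2 + m = m ^ 2.
  rewrite (bin_ffact m 2) ffactnS ffactn1; case: (m) => // p; rewrite /=; lia.
rewrite -(@leq_exp2r _ _ 2) // -(@leq_pmul2r (2 ^ m * (s ^ m) ^ 2)); last first.
  by rewrite muln_gt0 !expn_gt0 s0.
rewrite [leqRHS]mulnA -(expnM 2) -expnD binm.
rewrite [leqLHS](_ : _ = 8 ^ m * 4 ^ s * (r ^ s) ^ 2 * 2 ^ (2 * r ^ 2) * (n ^ 2 * s ^ 2) ^ m).
  rewrite (leq_trans (leq_mul (leqnn _) (leq_expn2r m ns))) //.
  rewrite expnMn -(expnM 2) -mulnA [2 ^ _ * _]mulnCA -expnD mulnA.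
  rewrite [leqRHS]mulnC leq_mul ?leq_pexp2l //.
    (* The constant 16 arises here: as [m <= 2 * s], the product [8 ^ m * 4 ^ s * C ^ m] is at most
       [(8 * C) ^ (2 * s) * 4 ^ s = (16 * C) ^ (2 * s)]. *)
    rewrite (leq_trans _ (leq_expn2r 2 (repeated_letters_bound K0 Ks rs))) //.
    have -> : ((16 * C * r) ^ s) ^ 2 = (8 * C) ^ (s * 2) * 4 ^ s * (r ^ s) ^ 2.
      rewrite -[16]/(8 * 2) -[4]/(2 * 2) expnM !expnMn; ring.
    have -> : 8 ^ m * 4 ^ s * (r ^ s) ^ 2 * C ^ m = (8 * C) ^ m * 4 ^ s * (r ^ s) ^ 2.
      by rewrite expnMn; ring.
    by rewrite !leq_mul // leq_pexp2l ?muln_gt0 // /m; lia.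
  by rewrite /m; nia.
have expnC a b c : (a ^ b) ^ c = (a ^ c) ^ b by rewrite -!expnM mulnC.
rewrite -[8]/(2 ^ 3) -[4]/(2 ^ 2) (expnMn (n ^ 2)) (expnC 2 3) (expnC 2 2) (expnC n) (expnC s 2).
rewrite [2 * _]mulnC expnM; ring.
Qed.

(** * Encoding graphs by words with repeated letters *)

Lemma enum_val_ltn (n : nat) (S : {set 'I_n}) (i j : 'I_#|S|) :
  i < j -> enum_val i < enum_val j.
Proof.
move=> ij; have /card_gt0P[x0 _] : 0 < #|S| by apply: leq_ltn_trans (ltn_ord j).
have sS : sorted (relpre val ltn) (enum S).
  rewrite /enum_mem; apply: sorted_filter => [x y z|]; first exact: ltn_trans.
  by rewrite -sorted_map -enumT val_enum_ord iota_ltn_sorted.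
rewrite !(enum_val_nth x0).
by apply: (sorted_ltn_nth _ x0 sS) => //; rewrite ?inE -?cardE // => x y z; apply: ltn_trans.
Qed.

Definition prescribed (V : finType) (m : nat) (v : 'I_m -> V) (c : 'I_m -> 'I_m)
    (D : {set 'I_m * 'I_m}) : {set sgraph V} :=
  [set G | [forall i : 'I_m, forall j : 'I_m,
              (i < j) ==> (adj G (v i) (v j) == ((c i, c j) \in D))]].

Lemma card_prescribed (V : finType) (m : nat) (v : 'I_m -> V) (c : 'I_m -> 'I_m)
    (D : {set 'I_m * 'I_m}) :
  injective v -> #|prescribed v c D| * 2 ^ 'C(m, 2) <= 2 ^ 'C(#|V|, 2).
Proof.
move=> vI; have vS : #|[set v i | i in 'I_m]| = m by rewrite card_imset // card_ord.
rewrite -[X in 'C(X, 2)]vS; apply: card_sgraph_prescribed => G H; rewrite !inE.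
move=> /forallP GP /forallP HP _ _ /imsetP[i _ ->] /imsetP[j _ ->].
have lt_case (a b : 'I_m) : a < b -> adj G (v a) (v b) = adj H (v a) (v b).
  move=> ab; have /forallP/(_ b)/implyP/(_ ab)/eqP -> := GP a.
  by have /forallP/(_ b)/implyP/(_ ab)/eqP -> := HP a.
case: (ltngtP i j) => [/lt_case//|/lt_case|/val_inj ->]; last by rewrite !adjxx.
by rewrite adjC [RHS]adjC.
Qed.

(* In a word, F is the set of first occurrences of the letters and c sends each
   position to the first occurrence of its letter; D is the decoder after
   renaming each letter by its first occurrence. *)
Definition word_code (m : nat) (F : {set 'I_m}) (c : {ffun 'I_m -> 'I_m})
    (D : {set 'I_m * 'I_m}) : bool :=
  (c \in family (fun i => if i \in F then pred1 i else mem F)) &&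
  (D \subset finset.setX F F).

(** On [F] the map is forced, the other [m - #|F|] positions choose freely in [F], and the decoder
    is any subset of the square of [F]. *)
Lemma card_word_code (m : nat) (F : {set 'I_m}) :
  #|[set cD | word_code F cD.1 cD.2]| = #|F| ^ (m - #|F|) * 2 ^ (#|F| ^ 2).
Proof.
pose A := [set c : {ffun 'I_m -> 'I_m} |
  c \in family (fun i => if i \in F then pred1 i else mem F)].
have -> : [set cD | word_code F cD.1 cD.2] = finset.setX A (powerset (finset.setX F F)).
  by apply/setP => -[c D]; rewrite !inE.
rewrite cardsX card_powerset cardsX mulnn; congr (_ * _).
rewrite cardsE card_family foldrE big_map big_enum /=.
rewrite (bigID (mem F)) /= big1 ?mul1n => [|i ->]; last by rewrite card1.
under eq_bigr => i /negPf -> do over.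
rewrite prod_nat_const; congr (_ ^ _).
apply: (@addnI #|F|); rewrite subnKC; last by rewrite -[leqRHS]card_ord max_card.
rewrite -[RHS]card_ord -(cardsC F); congr (_ + _).
by apply: eq_card => i; rewrite inE.
Qed.

Lemma exists_subset_card (T : finType) (A : {set T}) (s : nat) :
  s <= #|A| -> exists2 B : {set T}, B \subset A & #|B| = s.
Proof.
move=> sA; have [B] : exists B, B \in [set B : {set T} | B \subset A & #|B| == s].
  by apply/card_gt0P; rewrite cards_draws bin_gt0.
by rewrite inE => /andP[BA /eqP]; exists B.
Qed.

(** The repeated positions [T] and their first occurrences [F0] form a set closed under [first]; its
    increasing enumeration carries the word and decoder over to ['I_(s + r)]. *)
Lemma letter_graph_prescribed (V : finType) (G : sgraph V) (k s : nat) :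
    is_letter_graph G k -> s <= #|V| - k ->
  exists2 r : nat, r <= s & exists (F : {set 'I_(s + r)})
    (cD : {ffun 'I_(s + r) -> 'I_(s + r)} * {set 'I_(s + r) * 'I_(s + r)})
    (v : {ffun 'I_(s + r) -> V}),
    [/\ #|F| = r, word_code F cD.1 cD.2, injective v & G \in prescribed v cD.1 cD.2].
Proof.
move=> [Sigma [D [n [w [cardS [f f_bij adj_f]]]]]] sV.
have Vn : #|V| = n by rewrite (bij_eq_card f_bij) card_ord.
have [g fK gK] := f_bij.
pose first i := [arg min_(j < i | tnth w j == tnth w i) (j : nat)].
have w_first i : tnth w (first i) = tnth w i.
  by rewrite /first; case: arg_minnP => // j /eqP.
have eq_first i j : tnth w i = tnth w j -> first i = first j.
  have le_first i' j' : tnth w j' = tnth w i' -> first i' <= j'.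
    by rewrite /first; case: arg_minnP => // a _ + /eqP; apply.
  by move=> wij; apply/val_inj/eqP; rewrite eqn_leq !le_first // w_first.
have firstK i : first (first i) = first i := eq_first _ _ (w_first i).
pose Rep := [set i | first i != i].
have leRep : s <= #|Rep|.
  (* Positions that are their own first occurrence carry distinct letters, so there are at most [k]
     of them. *)
  rewrite (leq_trans sV) // Vn leq_subLR -cardS -[n in n <= _]card_ord -(cardsC Rep) addnC.
  rewrite leq_add2r -(card_in_imset (f := tnth w)) ?max_card // => i j.
  by rewrite !inE !negbK => /eqP fi /eqP fj /eq_first; rewrite fi fj.
have [T /subsetP sTR cardT] := exists_subset_card leRep.
pose F0 := first @: T; pose S := T :|: F0.
have TF0 : [disjoint T & F0].
  rewrite -setI_eq0; apply/eqP/setP => i; rewrite !inE; apply/negP => /andP[iT /imsetP[j _ ij]].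
  by have := sTR i iT; rewrite inE ij firstK eqxx.
(* Several positions of [T] may share a letter, so [r] can be smaller than [s]. *)
have [r cF0] : exists r, #|F0| = r by exists #|F0|.
have cS : #|S| = s + r by rewrite -cF0 /S cardsU disjoint_setI0 // cards0 subn0 cardT.
exists r; first by rewrite -cF0 -cardT leq_imset_card.
have first_S i : i \in S -> first i \in F0.
  rewrite inE => /orP[iT|/imsetP[j jT ->]]; first exact: imset_f.
  by rewrite firstK imset_f.
have F0_S i : i \in F0 -> i \in S by move=> iF; rewrite inE iF orbT.
(* Adjacency in a letter graph depends on the order of positions, so the enumeration of [S] must be
   increasing. *)
pose e (i : 'I_(s + r)) := enum_val (cast_ord (esym cS) i) : 'I_n.
have eS i : e i \in S by apply: enum_valP.
have e_ltn (i j : 'I_(s + r)) : i < j -> e i < e j by move=> ij; apply: enum_val_ltn.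
have e_inj : injective e by move=> i j /enum_val_inj /cast_ord_inj.
have e_surj a : a \in S -> exists i, e i = a.
  move=> aS; exists (cast_ord cS (enum_rank_in aS a)).
  by rewrite /e cast_ordK enum_rankK_in.
have c_ex i : exists j, e j == first (e i).
  by have [j <-] := e_surj _ (F0_S _ (first_S _ (eS i))); exists j.
pose c := [ffun i => xchoose (c_ex i)].
have ec i : e (c i) = first (e i) by rewrite ffunE; apply/eqP/(xchooseP (c_ex i)).
pose F := [set i | e i \in F0].
have F0E : F0 = e @: F.
  apply/setP => a; apply/idP/imsetP => [aF|[i iF ->]]; last by rewrite inE in iF.
  by have [i ia] := e_surj _ (F0_S _ aF); exists i; rewrite // inE ia.
pose D' := [set ij | [&& ij.1 \in F, ij.2 \in F & (tnth w (e ij.1), tnth w (e ij.2)) \in D]].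
have cF i : c i \in F by rewrite inE ec first_S.
exists F, (c, D'), [ffun i => g (e i)]; split=> /=.
- by move: cF0; rewrite {1}F0E card_imset.
- apply/andP; split.
    apply/familyP => i; case: ifPn => [iF|_]; last exact: cF.
    rewrite inE in iF; rewrite inE; apply/eqP/e_inj; rewrite ec.
    by have /imsetP[j _ ->] := iF; rewrite firstK.
  by apply/subsetP => -[i j]; rewrite !inE => /and3P[/= -> ->].
- by move=> i j; rewrite !ffunE => /(can_inj gK)/e_inj.
- rewrite inE; apply/forallP => i; apply/forallP => j; apply/implyP => ij.
  rewrite !(ffunE (fun i => g (e i))) adj_f !gK adj_letter_graph ?e_ltn //.
  by rewrite [X in _ == X]inE /= !cF /= !ec !w_first.
Qed.

Definition coded_graphs (V : finType) (s r : nat) : {set sgraph V} :=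
  \bigcup_(F : {set 'I_(s + r)} | #|F| == r)
    \bigcup_(x : {ffun 'I_(s + r) -> 'I_(s + r)} * {set 'I_(s + r) * 'I_(s + r)} *
                 {ffun 'I_(s + r) -> V} | word_code F x.1.1 x.1.2 && injectiveb x.2)
       prescribed x.2 x.1.1 x.1.2.

Lemma card_coded_graphs (V : finType) (s r : nat) :
  #|coded_graphs V s r| * 2 ^ 'C(s + r, 2)
    <= 2 ^ (s + r) * r ^ s * 2 ^ (r ^ 2) * #|V| ^ (s + r) * 2 ^ 'C(#|V|, 2).
Proof.
rewrite (leq_trans (leq_mul (leq_card_bigcup _ _) (leqnn _))) // big_distrl /=.
set m := s + r.
pose N := r ^ s * 2 ^ (r ^ 2) * #|V| ^ m * 2 ^ 'C(#|V|, 2).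
apply: leq_trans (_ : \sum_(F : {set 'I_m} | #|F| == r) N <= _); last first.
  rewrite sum_nat_const [leqRHS](_ : _ = 2 ^ m * N); last by rewrite /N !mulnA.
  rewrite leq_mul2r; apply/orP; right.
  (* The choices of [F] are bounded crudely by the number of all subsets. *)
  by rewrite (leq_trans (max_card _)) // -cardsT -powersetT card_powerset cardsT card_ord.
apply: leq_sum => F /eqP cF.
rewrite (leq_trans (leq_mul (leq_card_bigcup _ _) (leqnn _))) // big_distrl /=.
apply: leq_trans.
  apply: leq_sum => x /andP[_ /injectiveP]; exact: card_prescribed.
rewrite sum_nat_const leq_mul2r; apply/orP; right.
have -> : r ^ s * 2 ^ (r ^ 2) * #|V| ^ m =
    #|finset.setX [set cD | word_code F cD.1 cD.2] [set: {ffun 'I_m -> V}]|.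
  by rewrite cardsX card_word_code cF addnK cardsT card_ffun card_ord.
by rewrite subset_leq_card //; apply/subsetP => -[cD v]; rewrite !inE => /andP[->].
Qed.

(** For each of the [s.+1] values of [r], the coded graphs make up at most a fraction [2 ^ -s] of
    all graphs. *)
Lemma card_low_lettericity (C s : nat) (V : finType) (P : {set sgraph V}) :
    0 < C -> (16 * C) ^ (16 * C) <= s -> #|V| ^ 2 * s ^ 2 <= C * 2 ^ s ->
    {in P, forall G, s <= #|V| - lettericity G} ->
  #|P| * 2 ^ s <= s.+1 * 2 ^ 'C(#|V|, 2).
Proof.
move=> C0 Ks Vs low.
have sPU : P \subset \bigcup_(r < s.+1) coded_graphs V s r.
  apply/subsetP => G GP; have lG : is_letter_graph G (lettericity G).
    by rewrite /lettericity; case: ex_minnP => k /boolp.asboolP.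
  have [r rs [F [cD [v [/eqP cF wF /injectiveP vI Gpr]]]]] :=
    letter_graph_prescribed lG (low G GP).
  apply/bigcupP; exists (Ordinal (rs : r < s.+1)) => //.
  apply/bigcupP; exists F => //; apply/bigcupP; exists (cD, v) => //=.
  by rewrite wF.
rewrite (leq_trans (leq_mul (subset_leq_card sPU) (leqnn _))) //.
rewrite (leq_trans (leq_mul (leq_card_bigcup _ _) (leqnn _))) // big_distrl /=.
rewrite -[X in X * _](card_ord s.+1) -sum_nat_const; apply: leq_sum => -[r rs] _ /=.
have B0 : 0 < 2 ^ 'C(s + r, 2) by rewrite expn_gt0.
rewrite -(leq_pmul2r B0) mulnAC.
rewrite (leq_trans (leq_mul (card_coded_graphs V s r) (leqnn _))) //.
by rewrite mulnAC mulnC leq_mul2l (encodings_bound C0) ?orbT.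
Qed.

From mathcomp Require Import all_classical all_reals all_analysis.
Import Order.TTheory GRing.Theory Num.Theory.
Import numFieldNormedType.Exports.
Local Open Scope classical_set_scope.
Local Open Scope ring_scope.

(** * Probability and asymptotics *)

Lemma Gnp_prob_half (R : realType) (n : nat) (A : {set sgraph 'I_n}) :
  Gnp_prob (2^-1 : R) A = #|A|%:R / (2 ^ 'C(n, 2))%:R.
Proof.
rewrite /Gnp_prob (eq_bigr (fun=> (2 ^ 'C(n, 2))%:R^-1)) ?sumr_const ?mulr_natl //.
move=> G _; rewrite /Gnp_pmf (eq_bigr (fun=> 2^-1)) => [|e _].
  rewrite prodr_const natrX exprVn; congr (_ ^- _).
  by have := card_draws 'I_n 2; rewrite cardsE card_ord.
by case: ifP => // _; lra.
Qed.

Lemma ln2_ge (R : realType) : 2^-1 <= ln (2 : R).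
Proof.
have := @le_ln1Dx R (- 2^-1); rewrite (_ : 1 + - 2^-1 = 2^-1); last by lra.
by rewrite lnV ?posrE // => /(_ ltac:(lra)); lra.
Qed.

(** Take for [s] the least integer above [x = 2 * L + 2 * log2 L]. Then [2 ^ s] is at least
    [n ^ 2 * L ^ 2], while [s <= 6 * L]; hence [C = 36]. *)
Lemma repetition_count (R : realType) : exists2 C : nat, (0 < C)%N &
  forall M : nat, \forall n \near \oo, exists s : nat,
    [/\ (M <= s)%N, (n ^ 2 * s ^ 2 <= C * 2 ^ s)%N &
        forall k : nat, k%:R < n%:R - (2 * log2 n%:R + 2 * log2 (log2 n%:R)) :> R ->
          (s <= n - k)%N].
Proof.
exists 36%N => // M; near=> n.
have n_gt0 : 0 < n%:R :> R by rewrite ltr0n; near: n; exact: nbhs_infty_gt.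
have n2 : (2 <= n)%N by near: n; exact: nbhs_infty_ge.
(* This gives [M <= L <= x < s]. *)
have nM : (2 ^ M <= n)%N by near: n; exact: nbhs_infty_ge.
set L := log2 (n%:R : R); set x := 2 * L + 2 * log2 L.
have l2 := @ln2_ge R; have l2_gt0 : 0 < ln (2 : R) by lra.
have L_ge1 : 1 <= L by rewrite /L /log2 ler_pdivlMr // mul1r ler_ln ?posrE // ler_nat.
have L_gt0 : 0 < L by lra.
have LM : M%:R <= L.
  by rewrite /L /log2 ler_pdivlMr // mulr_natl -lnXn // ler_ln ?posrE ?exprn_gt0 // -natrX ler_nat.
have lL_ge0 : 0 <= log2 L by apply: divr_ge0; [exact: ln_ge0 | exact: ltW].
have lL_le : log2 L <= 2 * (L - 1).
  (* Dividing by [ln 2 >= 1/2] costs a factor of at most 2. *)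
  have lnL : ln L <= L - 1 by rewrite -[X in ln X](subrKC 1) le_ln1Dx //; lra.
  by rewrite /log2 ler_pdivrMr //; nra.
have x_ge0 : 0 <= x by rewrite /x; lra.
have [s xs sx] : exists2 s : nat, x < s%:R & s%:R <= x + 1.
  exists (Num.truncn x).+1; first exact: truncnS_gt.
  by rewrite -natr1 lerD2r truncn_le.
have s_le : s%:R <= 6 * L by move: sx lL_le; rewrite /x; lra.
exists s; split.
- by rewrite -(ler_nat R); move: xs LM lL_ge0; rewrite /x; lra.
- have exp_s : n%:R ^+ 2 * L ^+ 2 <= 2 ^+ s :> R.
    have n2_gt0 : 0 < n%:R ^+ 2 :> R by apply: exprn_gt0.
    have L2_gt0 : 0 < L ^+ 2 by apply: exprn_gt0.
    have s2_gt0 : 0 < 2 ^+ s :> R by apply: exprn_gt0.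
    rewrite -ler_ln ?posrE //; last exact: mulr_gt0.
    rewrite lnM ?posrE // !lnXn //.
    rewrite (_ : ln n%:R = L * ln 2); last by rewrite /L /log2 divfK ?gt_eqF.
    rewrite (_ : ln L = log2 L * ln 2); last by rewrite /log2 divfK ?gt_eqF.
    have : x * ln 2 <= s%:R * ln 2 by rewrite ler_pM2r // ltW.
    by rewrite -[ln 2 *+ s]mulr_natl !mulr2n /x; lra.
  rewrite -(ler_nat R) !natrM !natrX.
  apply: le_trans (_ : n%:R ^+ 2 * (6 * L) ^+ 2 <= _).
    by apply: ler_wpM2l; [exact: sqr_ge0 | rewrite ler_sqr ?nnegrE //; lra].
  by rewrite exprMn; move: exp_s; lra.
- move=> k kx.
  have kn : (k <= n)%N by rewrite -(ler_nat R); lra.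
  (* From [x < n - k] and [s <= x + 1] follows [s < n - k + 1], and integrality removes the 1. *)
  by rewrite -ltnS -(ltr_nat R) -natr1 natrB //; lra.
Unshelve. all: by end_near. Qed.

Theorem theorem3p2p6 (R : realType) :
  (fun n : nat =>
     Gnp_prob (2^-1 : R)
       [set G : sgraph 'I_n |
          (n%:R - (2 * log2 n%:R + 2 * log2 (log2 n%:R)) : R)
            <= (lettericity G)%:R]%SET)
    @ \oo --> (1 : R).
Proof.
have [C C0 repC] := repetition_count R.
apply/cvgrPdist_le => e e0; near=> n.
have n_gt0 : (0 < n)%N by near: n; exact: nbhs_infty_gt.
have [s [Ks ns lows]] : exists s : nat,
    [/\ ((16 * C) ^ (16 * C) <= s)%N, (n ^ 2 * s ^ 2 <= C * 2 ^ s)%N &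
        forall k : nat, k%:R < n%:R - (2 * log2 n%:R + 2 * log2 (log2 n%:R)) :> R ->
          (s <= n - k)%N] by near: n; exact: repC.
rewrite Gnp_prob_half; set A := [set G | _]%SET.
have s_gt0 : (0 < s)%N by apply: leq_trans Ks; rewrite expn_gt0 muln_gt0 C0.
(* The exceptional graphs form a fraction of at most [2 * C / n]. *)
have bad : (#|~: A| * n <= 2 * C * 2 ^ 'C(n, 2))%N.
  have low : {in ~: A, forall G, (s <= n - lettericity G)%N}.
    by move=> G; rewrite !inE -ltNge; apply: lows.
  have := @card_low_lettericity C s _ (~: A) C0 Ks; rewrite card_ord => /(_ ns low) bad_s.
  have p2s : (0 < 2 ^ s)%N by rewrite expn_gt0.
  rewrite -(leq_pmul2r p2s).
  rewrite mulnAC (leq_trans (leq_mul bad_s (leqnn n))) // mulnAC [leqRHS]mulnAC leq_mul2r.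
  (* Here [s.+1 * n <= 2 * (n ^ 2 * s ^ 2) <= 2 * (C * 2 ^ s)]. *)
  apply/orP; right; rewrite -mulnA (leq_trans _ (leq_mul (leqnn 2) ns)) //.
  by clear -n_gt0 s_gt0; nia.
set N := (2 ^ 'C(n, 2))%N in bad *.
have N_gt0 : 0 < N%:R :> R by rewrite ltr0n expn_gt0.
have cA : #|A|%:R + #|~: A|%:R = N%:R :> R by rewrite -natrD cardsC card_sgraph card_ord.
have N_neq0 : N%:R != 0 :> R by rewrite gt_eqF.
rewrite -[X in X - _](divff N_neq0) -mulrBl -[X in X - _]cA addrAC subrr add0r.
rewrite ger0_norm ?divr_ge0 // ler_pdivrMr //.
have n_ge : 2 * C%:R / e <= n%:R by near: n; exact: nbhs_infty_ger.
rewrite -(ler_pM2r (x := n%:R)) ?ltr0n //.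
move: n_ge; rewrite ler_pdivrMr // => n_ge.
have : #|~: A|%:R * n%:R <= 2 * C%:R * N%:R :> R by rewrite -!natrM ler_nat.
move=> /le_trans; apply.
by rewrite [leRHS](_ : _ = n%:R * e * N%:R) ?ler_pM2r //; ring.
Unshelve. all: by end_near. Qed.
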